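(* Let $E$ be a Banach space and let $C_1, C_2\geq 1$. If $E$ is $C_1$-isomorphic to a $C_2$-complemented subspace of a Banach lattice, then $\delta_E(E)$ is $C_1C_2$-complemented in $\mathrm{FBL}[E]$.
   Context: All spaces are real. Two Banach spaces $E,Y$ are $C$-isomorphic if there is a linear isomorphism $T:E\to Y$ onto $Y$ with $\|T\|\|T^{-1}\|\leq C$. A closed subspace $Y$ of a Banach space $X$ is $C$-complemented if it is the range of a bounded linear projection $P:X\to X$ with $\|P\|\leq C$. The free Banach lattice generated by a Banach space $E$ is a Banach lattice $\mathrm{FBL}[E]$ together with a linear isometric embedding $\delta_E:E\to \mathrm{FBL}[E]$ such that for every Banach lattice $X$ and every bounded linear operator $T:E\to X$ there is a unique lattice homomorphism $\widehat T:\mathrm{FBL}[E]\to X$ with $\widehat T\delta_E=T$, and moreover $\|\widehat T\|=\|T\|$. It exists and is unique up to lattice isometry. Concretely, it is the closed sublattice generated by the functions $\delta_E(x):E^*\to\mathbb R$, $\delta_E(x)(x^* )=x^*(x)$ ($x\in E$), in the Banach lattice (with pointwise order) of positively homogeneous functions $f:E^*\to\mathbb R$ with finite norm $\|f\|=\sup\{\sum_{k=1}^n|f(x_k^* )| : n\in\mathbb N,\ x_1^*,\dots,x_n^*\in E^*,\ \sup_{x\in B_E}\sum_{k=1}^n|x_k^*(x)|\leq 1\}$. *)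

(* Defs.v *)
From HB Require Import structures.
From mathcomp Require Import all_boot all_order all_algebra.
From mathcomp Require Import all_classical all_reals all_analysis.

Set Implicit Arguments.
Unset Strict Implicit.
Unset Printing Implicit Defensive.

Import Order.TTheory GRing.Theory Num.Theory.
Import numFieldNormedType.Exports.

Local Open Scope classical_set_scope.
Local Open Scope ring_scope.

(* The modulus of x is the join of x and - x; [`|x|] is the norm. The order is
   not an instance of [Order.Lattice] because Hierarchy Builder rejects a join
   of [CompleteNormedModule] and [Order.Lattice]: intermediate structures below
   [Num.RealDomain] are missing. *)
HB.mixin Record isBanachLattice (R : realType) (X : Type)
    of CompleteNormedModule R X := {
  bl_le : X -> X -> Prop ;
  bl_meet : X -> X -> X ;
  bl_join : X -> X -> X ;
  bl_le_refl : forall x, bl_le x x ;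
  bl_le_anti : forall x y, bl_le x y -> bl_le y x -> x = y ;
  bl_le_trans : forall x y z, bl_le x y -> bl_le y z -> bl_le x z ;
  bl_meetP : forall x y z, bl_le z (bl_meet x y) <-> bl_le z x /\ bl_le z y ;
  bl_joinP : forall x y z, bl_le (bl_join x y) z <-> bl_le x z /\ bl_le y z ;
  bl_le_addr : forall x y z, bl_le x y -> bl_le (x + z) (y + z) ;
  bl_scaler_ge0 : forall (a : R) x, 0 <= a -> bl_le 0 x -> bl_le 0 (a *: x) ;
  bl_norm_mono : forall x y,
    bl_le (bl_join x (- x)) (bl_join y (- y)) -> `|x| <= `|y|
}.

#[short(type="banachLatticeType")]
HB.structure Definition BanachLattice (R : realType) :=
  { X of CompleteNormedModule R X & isBanachLattice R X }.

Definition lattice_hom (R : realType) (X Y : banachLatticeType R)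
    (f : {linear X -> Y}) : Prop :=
  {morph f : x y / bl_meet x y} /\ {morph f : x y / bl_join x y}.

(* The operator norm of the restriction of f to A, as an extended real: a
   linear map f is bounded if and only if opnorm f < +oo. *)
Definition opnorm_on (R : realType) (V W : normedModType R) (A : set V)
    (f : V -> W) : \bar R :=
  ereal_sup [set `|f x|%:E | x in [set x | A x /\ `|x| <= 1]].

Definition opnorm (R : realType) (V W : normedModType R) (f : V -> W) : \bar R :=
  opnorm_on [set: V] f.

Definition closed_subspace (R : realType) (V : normedModType R) (Y : set V) :
    Prop :=
  submod_closed (mem Y) /\ closed Y.

Definition complemented (R : realType) (X : completeNormedModType R) (C : R)
    (Y : set X) : Prop :=
  closed_subspace Y /\
  exists P : {linear X -> X},
    [/\ forall x, P (P x) = P x, range P = Y & (opnorm P <= C%:E)%E].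

(* S is the inverse of the linear bijection T from E onto the subspace Y; its
   values outside Y are irrelevant. *)
Definition isomorphic_to_subspace (R : realType) (E X : completeNormedModType R)
    (C : R) (Y : set X) : Prop :=
  exists (T : {linear E -> X}) (S : X -> E),
    [/\ range T = Y, forall x, S (T x) = x, (opnorm T < +oo)%E,
        (opnorm_on Y S < +oo)%E & (opnorm T * opnorm_on Y S <= C%:E)%E].

(* (F, delta) satisfies the definition of the free Banach lattice over E, by
   its universal property. *)
Definition is_FBL (R : realType) (E : completeNormedModType R)
    (F : banachLatticeType R) (delta : {linear E -> F}) : Prop :=
  (forall x, `|delta x| = `|x|) /\
  forall (X : banachLatticeType R) (T : {linear E -> X}), (opnorm T < +oo)%E ->
    exists That : {linear F -> X},
      [/\ lattice_hom That, forall x, That (delta x) = T x,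
          opnorm That = opnorm T &
          forall U : {linear F -> X}, lattice_hom U ->
            (forall x, U (delta x) = T x) -> U =1 That].

(* Main.v *)
Require Import Defs.
From HB Require Import structures.
From mathcomp Require Import all_boot all_order all_algebra.
From mathcomp Require Import all_classical all_reals all_analysis.
Import Order.TTheory GRing.Theory Num.Theory.
Import numFieldNormedType.Exports.
Local Open Scope classical_set_scope.
Local Open Scope ring_scope.

(* Let T : E -> X be the embedding, S : T(E) -> E its inverse and P the
   projection of X onto T(E). If That : FBL[E] -> X is the lattice homomorphism
   extending T, then delta S P That is a projection onto delta(E), of norm at
   most |S| |P| |That| = |S| |P| |T|. *)

Set Implicit Arguments.
Unset Strict Implicit.

(** The hypothesis [A 0] keeps the supremum from being over the empty set, where it would be
    [-oo]. *)
Lemma opnorm_on_ge0 (R : realType) (V W : normedModType R) (A : set V)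
    (f : V -> W) :
  A 0 -> (0 <= opnorm_on A f)%E.
Proof.
move=> A0; apply: (@le_trans _ _ `|f 0|%:E); first by rewrite lee_fin.
by apply: ereal_sup_ubound; exists 0 => //=; rewrite normr0.
Qed.

Lemma opnorm_on_le (R : realType) (V W : normedModType R) (A : set V)
    (f : V -> W) (C : R) :
  0 <= C -> (forall x, A x -> `|f x| <= C * `|x|) ->
  (opnorm_on A f <= C%:E)%E.
Proof.
move=> C0 fC; apply: ge_ereal_sup => _ [x [Ax x1] <-].
rewrite lee_fin; apply: le_trans (fC x Ax) _.
by rewrite -[leRHS]mulr1 ler_wpM2l.
Qed.

(** Rescaling [x] to norm 1 stays inside [A]. Homogeneity is asked on [A] only, so that the lemma
    applies to the inverse [S], whose values outside [Y] are arbitrary. *)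
Lemma le_opnorm_on (R : realType) (V W : normedModType R) (A : set V)
    (f : V -> W) (C : R) :
  (forall a x, A x -> A (a *: x)) ->
  (forall a x, A x -> f (a *: x) = a *: f x) ->
  (opnorm_on A f <= C%:E)%E -> forall x, A x -> `|f x| <= C * `|x|.
Proof.
move=> AZ fZ fC x Ax; have [x0|x0] := eqVneq x 0.
  by rewrite x0 -(scale0r x) fZ // !scale0r !normr0 mulr0.
have nx : 0 < `|x| by rewrite normr_gt0.
have : (`|f (`|x|^-1 *: x)|%:E <= C%:E)%E.
  apply: le_trans fC; apply: ereal_sup_ubound; exists (`|x|^-1 *: x) => //=.
  split; first exact: AZ.
  by rewrite normrZ normfV normr_id mulVf // gt_eqF.
by rewrite lee_fin fZ // normrZ normfV normr_id mulrC ler_pdivrMr.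
Qed.

Lemma le_opnorm (R : realType) (V W : normedModType R) (f : {linear V -> W})
    (C : R) :
  (opnorm f <= C%:E)%E -> forall x, `|f x| <= C * `|x|.
Proof.
by move=> fC x; apply: (@le_opnorm_on R V W setT) => // a y _; rewrite linearZ.
Qed.

Lemma range_linear_submod_closed (R : realType) (V W : normedModType R)
    (f : {linear V -> W}) :
  submod_closed (mem (range f)).
Proof.
split=> [|a _ _ /set_mem[x _ <-] /set_mem[y _ <-]].
  by apply/mem_set; exists 0 => //; rewrite linear0.
by apply/mem_set; exists (a *: x + y) => //; rewrite linearP.
Qed.

(** By idempotence the range is the kernel of [P - id], which is continuous because [P] is
    bounded. *)
Lemma range_bounded_projection_closed (R : realType) (V : normedModType R)
    (P : {linear V -> V}) (C : R) :
  (forall x, P (P x) = P x) -> (opnorm P <= C%:E)%E -> closed (range P).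
Proof.
move=> PP PC.
have contP : continuous P.
  apply: bounded_linear_continuous; apply/linear_boundedP.
  near=> r => x; apply: (le_trans (le_opnorm PC x)).
  by apply: ler_wpM2r => //; near: r; apply: nbhs_pinfty_ge; rewrite num_real.
have -> : range P = (fun x => P x - x) @^-1` [set 0].
  apply/seteqP; split => [_ [x _ <-]|x] /=; first by rewrite PP subrr.
  by move=> /eqP; rewrite subr_eq0 => /eqP Px; exists x.
apply: preimage_closed; last first.
  exact/accessible_closed_set1/hausdorff_accessible/norm_hausdorff.
by move=> x _; exact: (cvgB (contP x) cvg_id).
Unshelve. all: by end_near. Qed.

Unset Implicit Arguments.
Set Strict Implicit.

Theorem proposition3p1 (R : realType) (E : completeNormedModType R)
    (F : banachLatticeType R) (delta : {linear E -> F}) (hF : is_FBL delta)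
    (C1 C2 : R) (hC1 : 1 <= C1) (hC2 : 1 <= C2)
    (hE : exists (X : banachLatticeType R) (Y : set X),
        complemented C2 Y /\ isomorphic_to_subspace E C1 Y) :
  complemented (C1 * C2) (range delta).
Proof.
case: hE => X [Y [[_ [P [PP rP PC]]] [T [S [rT ST Tfin Sfin TSC]]]]].
case: hF => isom /(_ X T Tfin) [That [_ Thatd nThat _]].
have YP x : Y (P x) by rewrite -rP; exists x.
have PT x : P (T x) = T x.
  have : range P (T x) by rewrite rP -rT; exists x.
  by move=> [z _ <-]; rewrite PP.
have TS y : Y y -> T (S y) = y by rewrite -rT => -[x _ <-]; rewrite ST.
(* [S] is a bare function; on [Y] it inherits linearity from [T], since each point of [Y] is some
   [T x] and [S (T x) = x]. *)
have SZD a y z : Y y -> Y z -> S (a *: y + z) = a *: S y + S z.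
  by rewrite -rT => -[x _ <-] [w _ <-]; rewrite -linearP !ST.
have YZ a y : Y y -> Y (a *: y).
  by rewrite -rT => -[x _ <-]; exists (a *: x); rewrite // linearZ.
have SZ a y : Y y -> S (a *: y) = a *: S y.
  by rewrite -rT => -[x _ <-]; rewrite -linearZ !ST.
have Y0 : Y 0 by rewrite -rT; exists 0; rewrite // linear0.
(* Both norms are nonnegative and below [+oo], so the bound on their product becomes an inequality
   between reals. *)
pose t := fine (opnorm T); pose s := fine (opnorm_on Y S).
have tE : opnorm T = t%:E.
  by rewrite fineK // ge0_fin_numE //; apply: opnorm_on_ge0.
have sE : opnorm_on Y S = s%:E.
  by rewrite fineK // ge0_fin_numE //; apply: opnorm_on_ge0.
have s0 : 0 <= s by rewrite -lee_fin -sE; exact: opnorm_on_ge0.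
have C20 : 0 <= C2 by apply: le_trans hC2.
have tsC : t * s <= C1 by rewrite -lee_fin EFinM -tE -sE.
pose q x := delta (S (P (That x))).
have q_lin : linear q by move=> a x y; rewrite /q !linearP SZD // linearP.
pose q_isLinear := GRing.isLinear.Build _ _ _ _ q q_lin.
pose Q : {linear F -> F} := HB.pack q q_isLinear.
(* [Q] fixes every [delta x]: [That] sends it to [T x], which [P] fixes and [S] sends back to
   [x]. *)
have QQ x : Q (Q x) = Q x by rewrite /= /q Thatd PT ST.
have rQ : range Q = range delta.
  apply/seteqP; split => _ [x _ <-] /=; first by exists (S (P (That x))).
  by exists (delta x) => //=; rewrite /q Thatd PT ST.
have QC : (opnorm Q <= (C1 * C2)%:E)%E.
  apply: opnorm_on_le => [|x _]; first by rewrite mulr_ge0 // (le_trans _ hC1).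
  (* The isometry [delta] drops out; the remaining factors contribute [s], [C2] and [t], the last
     because [That] has the same norm as [T]. *)
  rewrite /= /q isom.
  have Sle := @le_opnorm_on R X E Y S s YZ SZ.
  rewrite sE lexx in Sle; apply: le_trans (Sle isT _ (YP _)) _.
  apply: le_trans (ler_wpM2l s0 (le_opnorm PC _)) _.
  have Thatle : `|That x| <= t * `|x| by apply: le_opnorm; rewrite nThat tE.
  apply: le_trans (ler_wpM2l s0 (ler_wpM2l C20 Thatle)) _.
  rewrite !mulrA; apply: ler_wpM2r => //.
  by rewrite mulrAC (mulrC s); apply: ler_wpM2r.
split; last by exists Q.
(* Closedness of [range delta] comes from its being the range of the bounded projection [Q]. *)
rewrite -rQ; split; first exact: range_linear_submod_closed.
exact: range_bounded_projection_closed QQ QC.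
Qed.
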